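(* Let $F$ be a field of characteristic not two and let $E$ be a finite-dimensional vector space over $F$ with an arbitrary symmetric bilinear form $(U,V)\mapsto U\cdot V$. Suppose that a non-null projective triangle in $E$ is equilateral with common non-zero projective quadrance $q_1=q_2=q_3=q$, and with common projective spread $S_1=S_2=S_3=S$. Then $$(1-Sq)^2=4(1-S)(1-q).$$
   Context: A projective point $u=[U]$ is a one-dimensional subspace of $E$, spanned by a non-zero vector $U$; it is null if $U\cdot U=0$, and non-null otherwise. For distinct projective points $u,v$, $uv$ denotes the projective line (two-dimensional subspace) they span. A projective triangle $\overline{uvw}$ is a set of three distinct projective points not contained in a common two-dimensional subspace; it is null if at least one of its projective points is null, and non-null otherwise. Its projective quadrances are $q(v,w)$, $q(u,w)$, $q(u,v)$ and its projective spreads are, respectively, $S(uv,uw)$, $S(vw,vu)$, $S(wu,wv)$; it is equilateral when all its projective quadrances are equal. The projective quadrance between non-null projective points $u=[U]$, $v=[V]$ is $$q(u,v)=1-\frac{(U\cdot V)^2}{(U\cdot U)(V\cdot V)}.$$ The projective spread between the projective lines $wu$ and $wv$, where $u=[U]$, $v=[V]$, $w=[W]$ with $w$ non-null, is, putting $U'=U-\frac{U\cdot W}{W\cdot W}W$ and $V'=V-\frac{V\cdot W}{W\cdot W}W$, $$S(wu,wv)=1-\frac{(U'\cdot V')^2}{(U'\cdot U')(V'\cdot V')},$$ and it is undefined if one of the denominators is zero. Equivalently, with $a_X=X\cdot X$ and $b_{XY}=X\cdot Y$, $$S(wu,wv)=1-\frac{(a_Wb_{UV}-b_{UW}b_{VW})^2}{(a_Ua_W-b_{UW}^2)(a_Va_W-b_{VW}^2)}.$$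 The bilinear form is not assumed non-degenerate. *)

(* Defs.v *)
From mathcomp Require Import all_boot all_order all_algebra ring.

Set Implicit Arguments.
Unset Strict Implicit.
Unset Printing Implicit Defensive.

Import GRing.Theory.
Local Open Scope ring_scope.

(* [{symmetric E}] is the library type of symmetric bilinear forms [E -> E -> F];
   it does not require the form to be non-degenerate. *)

Section ProjectiveGeometry.
Variables (F : fieldType) (E : vectType F).
Implicit Types (B : {symmetric E}) (U V W : E) (u v w L : {vspace E}).

Definition proj_point u : Prop := \dim u = 1%N.

(* [vpick u] spans [u] when [u] is a projective point.  The values of the
   notions defined through [vpick] do not depend on this choice of a spanning
   vector: see [null_pointE], [quadranceE] and [spreadE]. *)
Definition null_point B u : Prop := B (vpick u) (vpick u) = 0.

Definition proj_triangle u v w : Prop :=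
  [/\ [/\ proj_point u, proj_point v & proj_point w],
      [/\ u <> v, u <> w & v <> w]
    & ~ (exists L, \dim L = 2%N /\ [/\ (u <= L)%VS, (v <= L)%VS & (w <= L)%VS])].

Definition nonnull_triangle B u v w : Prop :=
  [/\ proj_triangle u v w, ~ null_point B u, ~ null_point B v & ~ null_point B w].

(* Quadrances and spreads are partial: [None] means undefined. *)
Definition vquadrance B U V : option F :=
  if (B U U != 0) && (B V V != 0)
  then Some (1 - B U V ^+ 2 / (B U U * B V V)) else None.

Definition vproj B W U : E := U - (B U W / B W W) *: W.

Definition vspread B W U V : option F :=
  let U' := vproj B W U in
  let V' := vproj B W V in
  if [&& B W W != 0, B U' U' != 0 & B V' V' != 0]
  then Some (1 - B U' V' ^+ 2 / (B U' U' * B V' V')) else None.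

Definition quadrance B u v : option F := vquadrance B (vpick u) (vpick v).

(* [spread B w u v] is the spread S(wu, wv) between the lines [w + u] and
   [w + v]; that it depends on [u] and [v] only through these lines is
   [spread_lines]. *)
Definition spread B w u v : option F := vspread B (vpick w) (vpick u) (vpick v).

Lemma vpick_line U : U != 0 -> exists2 a : F, a != 0 & vpick <[U]>%VS = a *: U.
Proof.
move=> U0; have /vlineP[a aE] := memv_pick <[U]>%VS.
exists a => //; apply: contraNneq U0 => a0.
have /eqP : vpick <[U]>%VS = 0 by rewrite aE a0 scale0r.
by rewrite vpick0 -dimv_eq0 dim_vline; case: (U == 0).
Qed.

Lemma proj_pointP u : proj_point u -> u = <[vpick u]>%VS.
Proof.
move=> du; apply/esym/eqP; rewrite eqEdim; apply/andP; split.
  by rewrite -memvE memv_pick.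
by rewrite dim_vline vpick0 -dimv_eq0 du.
Qed.

Lemma vpick_neq0 u : proj_point u -> vpick u != 0.
Proof. by move=> du; rewrite vpick0 -dimv_eq0 du. Qed.

Lemma sformC B U V : B U V = B V U.
Proof. by rewrite hermitian_subproof expr0 mul1r. Qed.

Lemma sformDl B U V W : B (U + V) W = B U W + B V W.
Proof. exact: linearDl. Qed.

Lemma sformZl B a U V : B (a *: U) V = a * B U V.
Proof. by rewrite linearZl_LR. Qed.

Lemma sformZr B a U V : B U (a *: V) = a * B U V.
Proof. by rewrite sformC sformZl sformC. Qed.

Lemma null_pointE B U : U != 0 -> null_point B <[U]>%VS <-> B U U = 0.
Proof.
move=> /vpick_line[a a0 aE]; rewrite /null_point aE sformZl sformZr.
by split=> [/eqP|->]; rewrite ?mulr0 // !mulf_eq0 (negPf a0) => /eqP.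
Qed.

Lemma vquadranceZ B a b U V : a != 0 -> b != 0 ->
  vquadrance B (a *: U) (b *: V) = vquadrance B U V.
Proof.
move=> a0 b0; rewrite /vquadrance !sformZl !sformZr !mulf_eq0 (negPf a0) (negPf b0) /=.
case: ifP => // /andP[U0 V0]; congr (Some (1 - _)).
by field; rewrite a0 b0 U0 V0.
Qed.

Lemma vprojZl B c W U : c != 0 -> vproj B (c *: W) U = vproj B W U.
Proof.
move=> c0; rewrite /vproj !sformZl !sformZr scalerA; congr (_ - _ *: _).
have [->|W0] := eqVneq (B W W) 0; first by rewrite !mulr0 !invr0 !mulr0 mul0r.
by field; rewrite c0 W0.
Qed.

Lemma vprojD B W U a b : B W W != 0 ->
  vproj B W (a *: W + b *: U) = b *: vproj B W U.
Proof.
move=> W0; rewrite /vproj sformDl !sformZl mulrDl mulfK // scalerDl.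
by rewrite opprD addrACA subrr add0r scalerBr scalerA mulrA.
Qed.

Lemma vspreadZ B c a b c1 c2 W U V : c != 0 -> a != 0 -> b != 0 ->
  vspread B (c *: W) (c1 *: W + a *: U) (c2 *: W + b *: V) = vspread B W U V.
Proof.
move=> c0 a0 b0; rewrite /vspread sformZl sformZr !mulf_eq0 (negPf c0) /=.
have [//|W0] := eqVneq (B W W) 0; rewrite !vprojZl // !vprojD //=.
move: (vproj B W U) (vproj B W V) => U' V'.
rewrite !sformZl !sformZr !mulf_eq0 (negPf a0) (negPf b0) /=.
case: ifP => // /andP[U0 V0]; congr (Some (1 - _)).
by field; rewrite a0 b0 U0 V0.
Qed.

Lemma quadranceE B U V : U != 0 -> V != 0 ->
  quadrance B <[U]>%VS <[V]>%VS = vquadrance B U V.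
Proof.
move=> /vpick_line[a a0 aE] /vpick_line[b b0 bE].
by rewrite /quadrance aE bE vquadranceZ.
Qed.

Lemma spreadE B W U V : W != 0 -> U != 0 -> V != 0 ->
  spread B <[W]>%VS <[U]>%VS <[V]>%VS = vspread B W U V.
Proof.
move=> /vpick_line[c c0 cE] /vpick_line[a a0 aE] /vpick_line[b b0 bE].
rewrite /spread cE aE bE -[a *: U]add0r -[b *: V]add0r -(scale0r W).
exact: vspreadZ.
Qed.

Lemma vpick_join w u u' : proj_point w -> proj_point u -> proj_point u' ->
  w <> u' -> (w + u)%VS = (w + u')%VS ->
  exists a b : F, b != 0 /\ vpick u' = a *: vpick w + b *: vpick u.
Proof.
move=> dw du du' wu' wE.
have : vpick u' \in (<[vpick w]> + <[vpick u]>)%VS.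
  rewrite -(proj_pointP dw) -(proj_pointP du) wE.
  by rewrite (subvP (addvSr w u')) ?memv_pick.
move=> /memv_addP[_ /vlineP[a ->] [_ /vlineP[b ->] ab]].
exists a, b; split=> //; apply/eqP => b0; apply: wu'.
apply/esym/eqP; rewrite eqEdim dw du' leqnn andbT (proj_pointP du').
by rewrite -memvE ab b0 scale0r addr0 memvZ ?memv_pick.
Qed.

Lemma spread_lines B w u v u' v' :
  proj_point w -> proj_point u -> proj_point v ->
  proj_point u' -> proj_point v' -> w <> u' -> w <> v' ->
  (w + u)%VS = (w + u')%VS -> (w + v)%VS = (w + v')%VS ->
  spread B w u' v' = spread B w u v.
Proof.
move=> dw du dv du' dv' wu' wv' uE vE.
have [a [b [b0 abE]]] := vpick_join dw du du' wu' uE.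
have [c [d [d0 cdE]]] := vpick_join dw dv dv' wv' vE.
rewrite /spread abE cdE -{1}(scale1r (vpick w)).
by rewrite vspreadZ ?oner_neq0.
Qed.

End ProjectiveGeometry.

(* Main.v *)
Require Import Defs.
From mathcomp Require Import all_boot all_order all_algebra ring.
Import GRing.Theory.
Local Open Scope ring_scope.

(** The relation is the equilateral case of the projective cross law
      (S3 q1 q2 - q1 - q2 - q3 + 2)^2 = 4 (1 - q1) (1 - q2) (1 - q3),
    which links the three quadrances of a triangle to one of its spreads.

    Write a1, a2, a3 for the squares of spanning vectors U, V, W, and x, y, z
    for the products V.W, U.W, U.V.  The quadrances fix the squares x^2, y^2,
    z^2 up to the factors a1, a2, a3, whereas the spread at W, once denominators
    are cleared, involves (a3 z - x y)^2, whose cross term is a multiple of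
    x y z.  The spread therefore gives 2 x y z as a polynomial in the spread and
    the quadrances, times a1 a2 a3 ([cross_term]).  Squaring removes the choice
    of square roots, since (x y z)^2 is known from the quadrances alone; this is
    the cross law ([vcross_law]).

    When all the quadrances equal q, the difference of the two sides of the
    cross law is q^2 times that of the required identity, so the non-zero factor
    q^2 can be cancelled. *)

Section CrossLaw.
Variables (F : fieldType) (E : vectType F).
Implicit Types (B : {symmetric E}) (U V W : E).

Lemma sform_vproj B W U V : B W W != 0 ->
  B W W * B (vproj B W U) (vproj B W V) = B W W * B U V - B U W * B V W.
Proof.
move=> W0; rewrite /vproj -!scaleNr.
have sformDr X Y Z : B X (Y + Z) = B X Y + B X Z.
  by rewrite sformC sformDl !(sformC B _ X).
rewrite sformDl !sformDr !sformZl !sformZr (sformC B W V).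
by field.
Qed.

Lemma vquadrance_Some B U V q : vquadrance B U V = Some q ->
  [/\ B U U != 0, B V V != 0 & B U V ^+ 2 = (1 - q) * (B U U * B V V)].
Proof.
rewrite /vquadrance; case: ifP => // /andP[U0 V0] [<-]; split=> //.
by field; rewrite U0 V0.
Qed.

Lemma vspread_Some B W U V S : vspread B W U V = Some S ->
  (1 - S) * ((B W W * B U U - B U W ^+ 2) * (B W W * B V V - B V W ^+ 2)) =
  (B W W * B U V - B U W * B V W) ^+ 2.
Proof.
rewrite /vspread; case: ifP => // /and3P[W0 U0 V0] [<-].
rewrite !expr2 -!sform_vproj //.
by field; rewrite U0 V0.
Qed.

(** Substituting the quadrances, a3 a1 - y^2 = q2 a1 a3 and
    a3 a2 - x^2 = q1 a2 a3, so in the spread equation every term but the cross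
    term of the square carries the factor a1 a2 a3^2; one factor a3 cancels. *)
Lemma cross_term B U V W q1 q2 q3 S :
    vquadrance B V W = Some q1 -> vquadrance B U W = Some q2 ->
    vquadrance B U V = Some q3 -> vspread B W U V = Some S ->
  2%:R * (B V W * B U W * B U V) =
  (S * q1 * q2 - q1 - q2 - q3 + 2%:R) * (B U U * B V V * B W W).
Proof.
move=> /vquadrance_Some[_ W0 x2] /vquadrance_Some[_ _ y2].
move=> /vquadrance_Some[_ _ z2] /vspread_Some SE.
apply: (mulfI W0); move: SE x2 y2 z2.
move: (B V W) (B U W) (B U V) (B U U) (B V V) (B W W) => x y z a1 a2 a3.
move=> SE x2 y2 z2.
have -> : a3 * (2%:R * (x * y * z)) =
    a3 ^+ 2 * z ^+ 2 + y ^+ 2 * x ^+ 2 - (a3 * z - y * x) ^+ 2 by ring.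
by rewrite -SE x2 y2 z2; ring.
Qed.

Lemma vcross_law B U V W q1 q2 q3 S :
    vquadrance B V W = Some q1 -> vquadrance B U W = Some q2 ->
    vquadrance B U V = Some q3 -> vspread B W U V = Some S ->
  (S * q1 * q2 - q1 - q2 - q3 + 2%:R) ^+ 2 =
  4%:R * (1 - q1) * (1 - q2) * (1 - q3).
Proof.
move=> Q1 Q2 Q3 SS; have xyz := cross_term _ _ _ _ _ _ _ _ Q1 Q2 Q3 SS.
have [V0 W0 x2] := vquadrance_Some _ _ _ _ Q1.
have [U0 _ y2] := vquadrance_Some _ _ _ _ Q2.
have [_ _ z2] := vquadrance_Some _ _ _ _ Q3.
have a0 : (B U U * B V V * B W W) ^+ 2 != 0.
  by rewrite expf_neq0 // !mulf_neq0.
apply: (mulIf a0); rewrite -exprMn -xyz !exprMn x2 y2 z2.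
by ring.
Qed.

End CrossLaw.

Theorem theorem18 (F : fieldType) (charF : 2%N \notin [pchar F])
    (E : vectType F) (B : {symmetric E}) (u v w : {vspace E}) (q S : F)
    (uvw : nonnull_triangle B u v w) (q_neq0 : q != 0)
    (q1 : quadrance B v w = Some q)
    (q2 : quadrance B u w = Some q)
    (q3 : quadrance B u v = Some q)
    (S1 : spread B u v w = Some S)
    (S2 : spread B v w u = Some S)
    (S3 : spread B w u v = Some S) :
  (1 - S * q) ^+ 2 = 4%:R * (1 - S) * (1 - q).
Proof.
have /eqP := vcross_law _ _ _ _ _ _ _ _ _ _ q1 q2 q3 S3.
rewrite -subr_eq0 => /eqP cross.
have q2_neq0 : q ^+ 2 != 0 by rewrite expf_neq0.
apply/eqP; rewrite -subr_eq0; apply/eqP; apply: (mulfI q2_neq0).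
by rewrite mulr0 -cross; ring.
Qed.
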